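(* Let $w=[w_1\ldots w_n]\in S^{k,n}$, $1\le l\le n$, and let $s_{\lambda(w)}(x_2,\ldots,x_{k+1}|y)$ be the factorial Schur polynomial representing the equivariant Schubert class $\sigma_w$. Then the shuffle product satisfies $$(x_1|y)^{l-1}\ast s_{\lambda(w)}(x_2,\ldots,x_{k+1}|y)=(-1)^{\#(\psi_l^*.w,\,w)}\,s_{\lambda(\psi_l^*.w)}(x_1,\ldots,x_{k+1}|y)$$ if $l\notin\{w_1,\ldots,w_k\}$, and it is $0$ otherwise.
   Context: Fix $n\ge2$ and $1\le k\le n$; $R=\mathbb{Z}[y_1,\ldots,y_n]$. $S^{k,n}\subset S_n$ is the set of Grassmannian permutations $w=[w_1\ldots w_n]$ with $w_1<\cdots<w_k$ and $w_{k+1}<\cdots<w_n$; $\lambda(w)=(\lambda_1,\ldots,\lambda_k)$ is the partition with $w_j=\lambda_{k+1-j}+j$. $(x|y)^m=\prod_{i=1}^m(x-y_i)$, and the factorial Schur polynomial in $k$ variables is $s_\lambda(x_1,\ldots,x_k|y)=\det\big((x_j|y)^{\lambda_i+k-i}\big)_{1\le i,j\le k}/\prod_{i<j}(x_i-x_j)$. Shuffle product: for symmetric polynomials $f_1$ in $k_1$ variables and $f_2$ in $k_2$ variables over $R$, $$(f_1\ast f_2)(x_1,\ldots,x_{k_1+k_2})=\sum_{I,J}\frac{f_1(x_{i_1},\ldots,x_{i_{k_1}})\,f_2(x_{j_1},\ldots,x_{j_{k_2}})}{\prod_{a=1}^{k_1}\prod_{r=1}^{k_2}(x_{j_r}-x_{i_a})},$$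 the sum running over disjoint subsets $I=\{i_1<\cdots<i_{k_1}\}$, $J=\{j_1<\cdots<j_{k_2}\}$ with $I\cup J=\{1,\ldots,k_1+k_2\}$. Here $f_1$ is the one-variable polynomial $(x|y)^{l-1}$ and $f_2=s_{\lambda(w)}$ in $k$ variables. For $l\notin\{w_1,\ldots,w_k\}$, $\psi_l^*.w\in S^{k+1,n}$ is the Grassmannian permutation whose first $k+1$ values are $\{w_1,\ldots,w_k,l\}$ in increasing order. Combinatorially, $\lambda(\psi_l^*.w)$ is obtained from $\lambda(w)$ by adding a rim hook of length $l$ and then removing a column of height $k+1$; $\#(\psi_l^*.w,w)$ is the height (number of rows) of the added rim hook minus one. It equals the number of $j\le k$ with $w_j<l$. *)

(* Defs.v *)
From HB Require Import structures.
From mathcomp Require Import all_boot all_order all_algebra all_fingroup.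
From mathcomp Require Import fraction.
From mathcomp Require Import mpoly.

Set Implicit Arguments.
Unset Strict Implicit.
Unset Printing Implicit Defensive.

Import GRing.Theory.
Local Open Scope ring_scope.

Notation "x %:F" := (FracField.tofrac x) : ring_scope.

(** * Grassmannian permutations *)

(* One-line notation [w_1; ...; w_n] with values in {1, ..., n}: the entry w_j
   (j >= 1) sits at position j.-1 of the sequence. *)
Definition oneline (n : nat) (w : 'S_n) : seq nat :=
  [seq (w i).+1 | i <- enum 'I_n].

Definition grassmannian (n k : nat) : {set 'S_n} :=
  [set w : 'S_n | sorted ltn (take k (oneline w))
                  && sorted ltn (drop k (oneline w))].

(* The permutation listing the elements of A in increasing order, and then
   those of the complement of A in increasing order. *)
Definition grass_fun (n : nat) (A : {set 'I_n}) (i : 'I_n) : 'I_n :=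
  nth i (enum A ++ enum (~: A)) i.

Lemma grass_fun_inj (n : nat) (A : {set 'I_n}) : injective (grass_fun A).
Proof.
have szs : size (enum A ++ enum (~: A)) = n.
  by rewrite size_cat -!cardE cardsC card_ord.
have us : uniq (enum A ++ enum (~: A)).
  rewrite cat_uniq !enum_uniq /= andbT; apply/hasPn => x.
  by rewrite !mem_enum inE.
move=> i j; rewrite /grass_fun (set_nth_default i j) ?szs // => /eqP.
by rewrite nth_uniq ?szs // => /eqP /val_inj.
Qed.

Definition grass_perm (n : nat) (A : {set 'I_n}) : 'S_n :=
  perm (@grass_fun_inj n A).

(* psi_l^*.w, for l not in {w_1, ..., w_k}; i : 'I_n stands for the value i+1 *)
Definition psi (n k l : nat) (w : 'S_n) : 'S_n :=
  grass_perm [set i : 'I_n | i.+1 \in l :: take k (oneline w)].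

(* lambda(w) = (lambda_1, ..., lambda_k), where w_j = lambda_(k+1-j) + j.
   The 0-based index i stands for lambda_(i+1), so that j = k - i; for
   Grassmannian w, w_j >= j and the subtraction is exact. *)
Definition grass_part (n k : nat) (w : 'S_n) : k.-tuple nat :=
  [tuple (nth 0 (oneline w) (k - i).-1 - (k - i))%N | i < k].

(* Number of nonempty rows of the skew shape mu / lam (missing parts are 0) *)
Definition skew_height (lam mu : seq nat) : nat :=
  (\sum_(i < size mu) (nth 0 lam i < nth 0 mu i))%N.

(* #(psi_l^*.w, w). Since lambda(psi_l^*.w) arises from lambda(w) by adding a
   rim hook and then removing a column of height k+1, putting that column back
   gives the outer shape lambda(psi_l^*.w) + (1^(k+1)) of the rim hook. *)
Definition hook_sharp (n k l : nat) (w : 'S_n) : nat :=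
  (skew_height (grass_part k w) [seq p.+1 | p <- grass_part k.+1 (psi k l w)]).-1.

(** * Factorial Schur polynomials *)

(* (x|y)^m = (x - y_1) ... (x - y_m), for x in Z[y_1, ..., y_n][x_1, ..., x_k].
   Only m <= n is meaningful, as there are n parameters y; the exponents
   lambda_i + k - i coming from S^{k,n} are at most n - 1. *)
Definition fpow (n k : nat) (x : {mpoly {mpoly int[n]}[k]}) (m : nat) :
    {mpoly {mpoly int[n]}[k]} :=
  \prod_(i < n | (i < m)%N) (x - ('X_i)%:MP).

Definition vandermonde (n k : nat) : {mpoly {mpoly int[n]}[k]} :=
  \prod_(i < k) \prod_(j < k | (i < j)%N) ('X_i - 'X_j).

(* Indices are 0-based: the exponent is lambda_(i+1) + k - (i+1). *)
Definition schur_alternant (n k : nat) (lam : k.-tuple nat) :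
    {mpoly {mpoly int[n]}[k]} :=
  \det (\matrix_(i < k, j < k) fpow 'X_j (tnth lam i + (k - i.+1))).

(* A determinant det (p_i(x_j)) is divisible by prod_(i < j) (x_i - x_j). *)
Lemma det_horner_vandermonde (A : comNzRingType) (k : nat)
    (p : 'I_k -> {poly A}) (x : 'I_k -> A) :
  exists s : A, \det (\matrix_(i < k, j < k) (p i).[x j])
              = s * \prod_(i < k) \prod_(j < k | (i < j)%N) (x i - x j).
Proof.
elim: k p x => [|k IHk] p x.
  by exists 1; rewrite det_mx00 big_ord0 mulr1.
have /fin_all_exists [q qE] (i : 'I_k.+1) :
    exists q, p i - (p i).[x ord0]%:P = q * ('X - (x ord0)%:P).
  by apply/factor_theorem; rewrite /root !hornerE subrr.
pose B := \matrix_(i < k.+1, j < k.+1)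
  (if unlift ord0 j is Some _ then (q i).[x j] else (p i).[x ord0]).
pose T := \matrix_(i < k.+1, j < k.+1)
  (if unlift ord0 i is Some _ then (i == j)%:R * (x j - x ord0) else 1 : A).
have BT : \matrix_(i < k.+1, j < k.+1) (p i).[x j] = B *m T.
  apply/matrixP => i j; rewrite !mxE big_ord_recl !mxE unlift_none.
  have -> : (p i).[x j] = (p i).[x ord0] + (q i).[x j] * (x j - x ord0).
    have := congr1 (fun r => r.[x j]) (qE i).
    by rewrite !hornerE => <-; rewrite addrC subrK.
  rewrite mulr1; congr (_ + _); under eq_bigr => r _ do rewrite !mxE liftK.
  case: (unliftP ord0 j) => [j' ->|->].
    rewrite (bigD1 j') //= eqxx mul1r big1 ?addr0 // => r /negPf nrj.
    by rewrite (inj_eq lift_inj) nrj mul0r mulr0.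
  by rewrite subrr mulr0 big1 // => r _; rewrite mulr0 mulr0.
have detT : \det T = \prod_(j < k) (x (lift ord0 j) - x ord0).
  rewrite -det_tr det_trig; last first.
    apply/is_trig_mxP => i j ij; rewrite !mxE.
    case: unliftP => [r jE|jE]; last by rewrite jE ltn0 in ij.
    by case: eqP ij => [->|_ _]; rewrite ?ltnn // mul0r.
  rewrite big_ord_recl !mxE unlift_none mul1r.
  by apply: eq_bigr => j _; rewrite !mxE liftK eqxx mul1r.
have [s sE] : exists s, \det B = s * \prod_(i < k) \prod_(j < k | (i < j)%N)
                                  (x (lift ord0 i) - x (lift ord0 j)).
  rewrite (expand_det_col B ord0).
  have /fin_all_exists [t tE] (i : 'I_k.+1) :=
    IHk (fun r => q (lift i r)) (fun j => x (lift ord0 j)).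
  exists (\sum_i B i ord0 * ((-1) ^+ (i + 0) * t i)).
  rewrite mulr_suml; apply: eq_bigr => i _; rewrite /cofactor.
  rewrite -!mulrA -tE; congr (_ * (_ * \det _)).
  by apply/matrixP => r c; rewrite !mxE liftK.
exists ((-1) ^+ k * s); rewrite BT det_mulmx sE detT big_ord_recl /=.
under [X in _ = _ * (_ * X)]eq_bigr => i _.
  rewrite big_mkcond big_ord_recl /= mul1r.
  under eq_bigr => j _ do rewrite /bump /= !add1n ltnS.
  rewrite -big_mkcond; over.
have -> : \prod_(j < k) (x (lift ord0 j) - x ord0)
        = (-1) ^+ k * \prod_(j < k.+1 | (0 < j)%N) (x ord0 - x j).
  rewrite [X in _ * X]big_mkcond big_ord_recl /= mul1r.
  rewrite -[in (-1) ^+ k](card_ord k) -prodr_const -big_split /=.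
  by apply: eq_bigr => j _; rewrite mulN1r opprB.
by rewrite mulrC -!mulrA; congr (_ * _); rewrite mulrCA.
Qed.

Lemma factorial_schur_subproof (n k : nat) (lam : k.-tuple nat) :
  exists s : {mpoly {mpoly int[n]}[k]},
    s * vandermonde n k == schur_alternant n lam.
Proof.
pose p i : {poly {mpoly {mpoly int[n]}[k]}} :=
  \prod_(r < n | (r < tnth lam i + (k - i.+1))%N) ('X - ('X_r)%:MP%:P).
have [s sE] := det_horner_vandermonde p (fun j => 'X_j).
exists s; rewrite -sE; apply/eqP; congr (\det _).
apply/matrixP => i j; rewrite !mxE horner_prod.
by apply: eq_bigr => r _; rewrite !hornerE.
Qed.

(* The (unique) polynomial quotient of the alternant by the Vandermonde
   product *)
Definition factorial_schur (n k : nat) (lam : k.-tuple nat) :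
    {mpoly {mpoly int[n]}[k]} :=
  xchoose (factorial_schur_subproof n lam).

Lemma factorial_schurE (n k : nat) (lam : k.-tuple nat) :
  factorial_schur n lam * vandermonde n k = schur_alternant n lam.
Proof. exact: (eqP (xchooseP (factorial_schur_subproof n lam))). Qed.

(** * Shuffle product *)

(* (x_(i_1), ..., x_(i_m)) for I = {i_1 < ... < i_m} *)
Definition vars_of (n N m : nat) (I : {set 'I_N}) :
    m.-tuple {mpoly {mpoly int[n]}[N]} :=
  [tuple nth 0 [seq 'X_i | i <- enum I] r | r < m].

(* The sum is taken in the field of fractions of
   Z[y_1, ..., y_n][x_1, ..., x_(k1+k2)]. *)
Definition shuffle (n k1 k2 : nat) (f1 : {mpoly {mpoly int[n]}[k1]})
    (f2 : {mpoly {mpoly int[n]}[k2]}) :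
    {fraction {mpoly {mpoly int[n]}[k1 + k2]}} :=
  \sum_(I : {set 'I_(k1 + k2)} | #|I| == k1)
    (comp_mpoly (vars_of n k1 I) f1 * comp_mpoly (vars_of n k2 (~: I)) f2)%:F
    / (\prod_(i in I) \prod_(j in ~: I) ('X_j - 'X_i))%:F.

(* Main.v *)
Require Import Defs.
From mathcomp Require Import all_boot all_order all_algebra all_fingroup.
From mathcomp Require Import fraction.
From mathcomp Require Import mpoly.
From mathcomp Require Import zify ring.

Import GRing.Theory.
Local Open Scope ring_scope.

(**
The shuffle product with a polynomial in one variable is a Laplace expansion.
A factorial Schur polynomial is an alternant divided by a Vandermonde product,
and the Vandermonde product in x_1, ..., x_(k+1) equals, up to the sign
(-1)^(k+1-i), the Vandermonde product in the variables other than x_i times the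
denominator prod_(j <> i) (x_j - x_i) of the i-th term of the shuffle sum
([vandermonde_lift]). Multiplying the shuffle sum by the full Vandermonde
product therefore clears all denominators and leaves the expansion, along the
row of the (x_i|y)^(l-1), of the determinant obtained by inserting that row
into the alternant of lambda(w) ([shuffle_vandermonde]).

The row of that alternant with index k-j (j = 1, ..., k, rows counted from 0)
has entries (x_i|y)^(w_j - 1), as lambda_(k+1-j) + j - 1 = w_j - 1. If l is one
of the w_j, the inserted row repeats a row and the determinant vanishes.
Otherwise let p be the number of the w_j below l. Inserted at index k-p, the new
row comes exactly where the decreasing order of the exponents puts it, so that
the determinant is the alternant of lambda(psi_l^*.w), whose first k+1 values
are the w_j together with l in increasing order; the sign left over from the
expansion is (-1)^p. Finally p is the height of the rim hook minus one
([hook_sharpE]): in terms of values, the row of the hook shape that comes from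
the value at position j+1 of psi_l^*.w (j = 0, ..., k) is longer than the
corresponding row of lambda(w) exactly when that value exceeds w_j (with
w_0 = 0), that is, when j <= p.
*)

(** * Singling out one variable *)

Lemma ltn_lift (k : nat) (i : 'I_k.+1) (a b : 'I_k) :
  (lift i a < lift i b)%N = (a < b)%N.
Proof. by rewrite /= /bump; lia. Qed.

(** Separating the factors that involve x_i from the Vandermonde product: those
    with x_i on the left, one for each of the k - i indices above i, have to
    change sign. As (-1) ^+ (k - i) = (-1) ^+ (k + i), the sign is written
    without the truncated subtraction. *)
Lemma vandermonde_lift (A : comNzRingType) (k : nat) (x : 'I_k.+1 -> A)
    (i : 'I_k.+1) :
  \prod_(a < k.+1) \prod_(b < k.+1 | (a < b)%N) (x a - x b)
  = (-1) ^+ (k + i) * \prod_(a < k) (x (lift i a) - x i)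
    * \prod_(a < k) \prod_(b < k | (a < b)%N) (x (lift i a) - x (lift i b)).
Proof.
rewrite (bigD1_ord i) //= big_mkcond (bigD1_ord i) //= ltnn mul1r.
under [X in _ * X = _]eq_bigr => a _.
  rewrite big_mkcond (bigD1_ord i) //= -big_mkcond /=.
  under eq_bigl => b do rewrite ltn_lift.
  over.
rewrite big_split /= mulrA -big_split /=; congr (_ * _).
(* The sign is distributed over the variables other than x_i, so that the two
   sides can be compared factor by factor. *)
have -> : (-1) ^+ (k + i) = \prod_(a < k) (if (a < i)%N then 1 else -1) :> A.
  have le_ik : (i <= k)%N by rewrite -ltnS.
  have signE m : (-1) ^+ m = \prod_(a < m) -1 :> A by rewrite prodr_const card_ord.
  rewrite exprD !signE.
  rewrite (big_ord_widen k (fun=> -1 : A) le_ik) [X in _ * X = _]big_mkcond.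
  rewrite -big_split /=; apply: eq_bigr => a _ /=.
  by case: ifP; rewrite ?mulrNN mulr1.
rewrite -big_split /=; apply: eq_bigr => a _ /=.
have [lt_ai|le_ia] := ltnP a i.
  have -> : (i < bump i a)%N = false by rewrite /bump; lia.
  have -> : (bump i a < i)%N by rewrite /bump; lia.
  by rewrite mul1r.
have -> : (i < bump i a)%N by rewrite /bump; lia.
have -> : (bump i a < i)%N = false by rewrite /bump; lia.
by rewrite mulr1 mulN1r opprB.
Qed.

Lemma enum_setC1 (k : nat) (i : 'I_k.+1) :
  enum (~: [set i]) = [seq lift i j | j <- enum 'I_k].
Proof.
apply: (inj_map val_inj); apply: (irr_sorted_eq ltn_trans ltnn).
- apply: (subseq_sorted ltn_trans) (iota_ltn_sorted 0 k.+1).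
  by rewrite -val_enum_ord map_subseq // enumT filter_subseq.
- rewrite -map_comp sorted_map.
  apply: (@sub_sorted _ (relpre val ltn)) => [a b|]; first by rewrite /= ltn_lift.
  by rewrite -sorted_map val_enum_ord iota_ltn_sorted.
- move=> a; apply/mapP/mapP => [] [b]; rewrite ?mem_enum => bP ->.
    exists b => //; move: bP; rewrite !inE; case: (unliftP i b) => [j -> _|->].
      by rewrite map_f ?mem_enum.
    by rewrite eqxx.
  case/mapP: bP => j _ ->; exists (lift i j) => //.
  by rewrite mem_enum !inE eq_sym neq_lift.
Qed.

Lemma vars_of_set1 (n k : nat) (i : 'I_k) :
  (vars_of n 1 [set i])`_0 = 'X_i.
Proof. by rewrite -[LHS](tnth_nth 0 _ ord0) tnth_mktuple enum_set1. Qed.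

Lemma vars_of_setC1 (n k : nat) (i : 'I_k.+1) (j : 'I_k) :
  (vars_of n k (~: [set i]))`_j = 'X_(lift i j).
Proof.
rewrite /vars_of -tnth_nth tnth_mktuple enum_setC1 -map_comp.
by rewrite (nth_map j) ?size_enum_ord // nth_ord_enum.
Qed.

Lemma comp_fpow (n N m e : nat) (i : 'I_N) (lq : N.-tuple {mpoly {mpoly int[n]}[m]}) :
  fpow 'X_i e \mPo lq = fpow lq`_i e.
Proof.
rewrite /fpow rmorph_prod; apply: eq_bigr => j _ /=.
by rewrite rmorphB /= comp_mpolyXU comp_mpolyC.
Qed.

Lemma mpolyXU_neq (R : nzRingType) (n : nat) (i j : 'I_n) :
  i != j -> 'X_i - 'X_j != 0 :> {mpoly R[n]}.
Proof.
move=> ne_ij; apply/eqP => /(congr1 (mcoeff U_(i)))/eqP.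
by rewrite mcoeffB !mcoeffXU mcoeff0 eqxx (eq_sym j) (negPf ne_ij) subr0 oner_eq0.
Qed.

Lemma mpoly_vandermonde_neq0 (R : idomainType) (k : nat) :
  \prod_(i < k) \prod_(j < k | (i < j)%N) ('X_i - 'X_j) != 0 :> {mpoly R[k]}.
Proof.
apply/prodf_neq0 => i _; apply/prodf_neq0 => j lt_ij.
by apply: mpolyXU_neq; rewrite neq_ltn lt_ij.
Qed.

(** This is how the denominator of one term of the shuffle sum cancels against
    the Vandermonde product. *)
Lemma tofrac_divMK (R : idomainType) (N : nat) (a c d v : {mpoly R[N]}) :
  d != 0 -> a%:F / d%:F * (c * d * v)%:F = (a * (c * v))%:F.
Proof.
move=> d_neq0; rewrite -(mulrA c) (mulrCA c) !tofracM [LHS]mulrA divfK //.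
by rewrite tofrac_eq0.
Qed.

Lemma tofrac_mulA (R : idomainType) (N : nat) (c s v : {mpoly R[N]}) :
  (c * (s * v))%:F = (c * s)%:F * v%:F.
Proof. by rewrite mulrA tofracM. Qed.

Lemma prod_lift_subX_neq0 (R : idomainType) (k : nat) (i : 'I_k.+1) :
  \prod_(a < k) ('X_(lift i a) - 'X_i) != 0 :> {mpoly R[k.+1]}.
Proof.
by apply/prodf_neq0 => a _; apply: mpolyXU_neq; rewrite eq_sym neq_lift.
Qed.

(** * The shuffle product as a Laplace expansion *)

Definition inserted_alternant (n : nat) {k : nat} (m : nat) (lam : k.-tuple nat)
    (r : 'I_k.+1) : {mpoly {mpoly int[n]}[k.+1]} :=
  \det (\matrix_(i < k.+1, j < k.+1)
    fpow 'X_j (if unlift r i is Some i' then tnth lam i' + (k - i'.+1) else m)%N).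

(** The term of the shuffle sum where x_i is singled out becomes, after
    multiplication by the Vandermonde product, the term of column i in the
    Laplace expansion along the inserted row. The row index r is free: moving
    the inserted row changes the determinant by the sign that (-1) ^+ r
    compensates, so the place that suits the application can be chosen. *)
Lemma shuffle_vandermonde (n k m : nat) (lam : k.-tuple nat) (r : 'I_k.+1) :
  shuffle (fpow ('X_ord0 : {mpoly {mpoly int[n]}[1]}) m) (factorial_schur n lam)
    * (vandermonde n k.+1)%:F
  = ((-1) ^+ (k + r) * inserted_alternant n m lam r)%:F.
Proof.
rewrite /shuffle big_cards1 mulr_suml /inserted_alternant.
rewrite (expand_det_row _ r) mulr_sumr (raddf_sum (@FracField.tofrac _)).
apply: eq_bigr => i _ /=.
rewrite comp_fpow vars_of_set1 big_set1.
set g := _ \mPo _.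
have -> : \prod_(j in ~: [set i]) ('X_j - 'X_i)
    = \prod_(a < k) ('X_(lift i a) - 'X_i) :> {mpoly {mpoly int[n]}[k.+1]}.
  by rewrite -big_enum enum_setC1 big_map big_enum.
set d := \prod_(a < k) _.
set V := \prod_(a < k) \prod_(b < k | (a < b)%N)
  ('X_(lift i a) - 'X_(lift i b) : {mpoly {mpoly int[n]}[k.+1]}).
(* Substituting the variables other than x_i into the equation that defines
   the factorial Schur polynomial. *)
have gV : g * V = \det (\matrix_(a < k, b < k)
    fpow ('X_(lift i b) : {mpoly {mpoly int[n]}[k.+1]}) (tnth lam a + (k - a.+1))).
  have := congr1 (comp_mpoly (vars_of n k (~: [set i]))) (factorial_schurE n lam).
  rewrite rmorphM /= -/g /vandermonde rmorph_prod /schur_alternant -det_map_mx /=.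
  under eq_bigr => a _.
    rewrite rmorph_prod /=.
    under eq_bigr => b _ do rewrite rmorphB /= !comp_mpolyXU !vars_of_setC1.
    over.
  move=> ->; congr (\det _); apply/matrixP => a b.
  by rewrite !mxE comp_fpow vars_of_setC1.
rewrite /vandermonde (vandermonde_lift _ _ (fun a => 'X_a) i) -/d -/V.
rewrite mxE unlift_none /cofactor.
have -> : row' r (col' i (\matrix_(i < k.+1, j < k.+1)
    fpow ('X_j : {mpoly {mpoly int[n]}[k.+1]})
      (if unlift r i is Some i' then tnth lam i' + (k - i'.+1) else m)%N))
  = \matrix_(a < k, b < k) fpow 'X_(lift i b) (tnth lam a + (k - a.+1)).
  by apply/matrixP => a b; rewrite !mxE liftK.
rewrite -gV.
have -> : (-1) ^+ (k + r) * (fpow 'X_i m * ((-1) ^+ (r + i) * (g * V)))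
    = fpow 'X_i m * g * ((-1) ^+ (k + i) * V).
  rewrite !exprD.
  have sqr_r : (-1) ^+ r * (-1) ^+ r = 1 :> {mpoly {mpoly int[n]}[k.+1]}.
    by rewrite -expr2 sqrr_sign.
  by ring: sqr_r.
exact: tofrac_divMK (prod_lift_subX_neq0 _ _ _).
Qed.

(** * One-line notation *)

Lemma size_oneline (n : nat) (w : 'S_n) : size (oneline w) = n.
Proof. by rewrite size_map size_enum_ord. Qed.

Lemma mem_oneline (n : nat) (w : 'S_n) (x : nat) :
  x \in oneline w -> (0 < x <= n)%N.
Proof. by case/mapP => i _ ->; rewrite ltn_ord. Qed.

Lemma oneline_grass_perm (n : nat) (A : {set 'I_n}) :
  take #|A| (oneline (grass_perm A)) = [seq i.+1 | i : 'I_n <- enum A].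
Proof.
suff -> : oneline (grass_perm A) = [seq i.+1 | i : 'I_n <- enum A ++ enum (~: A)].
  by rewrite map_cat take_size_cat // size_map -cardE.
have sz : size (enum A ++ enum (~: A)) = n.
  by rewrite size_cat -!cardE cardsC card_ord.
apply: (@eq_from_nth _ 0) => [|j]; rewrite size_oneline ?size_map // => lt_jn.
rewrite !(nth_map (Ordinal lt_jn)) ?size_enum_ord ?sz -?enumT ?size_enum_ord //.
by rewrite (nth_ord_enum _ (Ordinal lt_jn)) permE.
Qed.

Lemma sorted_map_enum (n : nat) (A : {set 'I_n}) :
  sorted ltn [seq i.+1 | i : 'I_n <- enum A].
Proof.
apply: (@subseq_sorted _ _ ltn_trans _ (iota 1 n)); last exact: iota_ltn_sorted.
rewrite -[1%N]add1n iotaDl -val_enum_ord -map_comp.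
by rewrite map_subseq // enumT filter_subseq.
Qed.

Lemma sorted_ltn_cat_cons (s : seq nat) (l : nat) :
  sorted ltn s ->
  sorted ltn ([seq x <- s | x < l] ++ l :: [seq x <- s | l < x])%N.
Proof.
move=> s_sorted; rewrite (sorted_pairwise ltn_trans) pairwise_cat /=.
rewrite -!(sorted_pairwise ltn_trans) !(sorted_filter ltn_trans) // andbT /=.
rewrite filter_all andbT; apply/allrelP => x y.
rewrite mem_filter inE mem_filter => /andP[lt_xl _] /orP[/eqP -> //|].
by case/andP => lt_ly _; apply: ltn_trans lt_ly.
Qed.

Lemma cat_filter_ltn (s : seq nat) (l : nat) :
  sorted ltn s -> l \notin s ->
  s = ([seq x <- s | x < l] ++ [seq x <- s | l < x])%N.
Proof.
move=> s_sorted l_s; apply: (irr_sorted_eq ltn_trans ltnn) => //.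
  have := sorted_ltn_cat_cons _ l s_sorted.
  apply: (subseq_sorted ltn_trans).
  by rewrite cat_subseq // subseq_cons.
move=> x; rewrite mem_cat !mem_filter -andb_orl -neq_ltn.
by case: eqVneq => [->|//]; rewrite (negPf l_s).
Qed.

(** Both sides are strictly increasing sequences with the same members, so they
    agree; the form on the right shows how the positions of the old values are
    shifted by the insertion of l. *)
Lemma take_oneline_psi (n k l : nat) (w : 'S_n) (s := take k (oneline w)) :
  (k <= n)%N -> (0 < l <= n)%N -> sorted ltn s -> l \notin s ->
  take k.+1 (oneline (psi k l w))
  = ([seq x <- s | x < l] ++ l :: [seq x <- s | l < x])%N.
Proof.
move=> le_kn l_bounds s_sorted l_s; set t := RHS.
have size_t : size t = k.+1.
  rewrite size_cat /= addnS -size_cat -cat_filter_ltn //.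
  by rewrite size_take_min size_oneline (minn_idPl le_kn).
rewrite /psi -/s; set A := [set i | _].
have tE : [seq i.+1 | i : 'I_n <- enum A] = t.
  apply: (irr_sorted_eq ltn_trans ltnn); first exact: sorted_map_enum.
    exact: sorted_ltn_cat_cons.
  move=> x; have -> : (x \in t) = (x \in l :: s).
    rewrite mem_cat !inE !mem_filter; case: (ltngtP x l) => //= _.
    by rewrite orbF.
  apply/mapP/idP => [[i]|x_ls]; first by rewrite mem_enum inE => ? ->.
  have /andP[x_gt0 le_xn] : (0 < x <= n)%N.
    by move: x_ls; rewrite inE => /predU1P[-> //|/mem_take/mem_oneline].
  have lt_xn : (x.-1 < n)%N by rewrite prednK.
  by exists (Ordinal lt_xn); rewrite ?mem_enum ?inE /= prednK.
by rewrite -[in LHS]size_t -[in LHS]tE size_map -cardE oneline_grass_perm.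
Qed.

Lemma ltn_nth_sorted (s : seq nat) (j : nat) :
  sorted ltn s -> {in s, forall x, (0 < x)%N} -> (j < size s)%N ->
  (j < nth 0%N s j)%N.
Proof.
move=> s_sorted s_gt0; elim: j => [|j IHj] lt_js.
  by apply: s_gt0; rewrite mem_nth.
apply: leq_ltn_trans (IHj (ltnW lt_js)) _.
by apply: (sorted_ltn_nth ltn_trans) => //; rewrite inE // ltnW.
Qed.

(** This is why the truncated subtraction in the definition of lambda(w) is
    exact. *)
Lemma ltn_nth_oneline (n k j : nat) (w : 'S_n) :
  sorted ltn (take k (oneline w)) -> (j < k <= n)%N ->
  (j < nth 0%N (oneline w) j)%N.
Proof.
move=> w_sorted /andP[lt_jk le_kn]; rewrite -(nth_take 0%N lt_jk).
apply: ltn_nth_sorted => // [x /mem_take/mem_oneline/andP[] //|].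
by rewrite size_take_min size_oneline (minn_idPl le_kn).
Qed.

(** The exponent lambda_i + k - i of a row of the alternant is w_(k+1-i) - 1:
    the rows are the factorial powers attached to the values of w, taken in
    decreasing order. *)
Lemma grass_part_exponent (n k : nat) (w : 'S_n) (i : 'I_k) :
  (k <= n)%N -> sorted ltn (take k (oneline w)) ->
  (tnth (grass_part k w) i + (k - i.+1)
   = (nth 0 (take k (oneline w)) (k - i.+1)).-1)%N.
Proof.
move=> le_kn w_sorted; have lt_ik := ltn_ord i.
rewrite tnth_mktuple nth_take; last by lia.
have -> : (k - i).-1 = (k - i.+1)%N by lia.
have := @ltn_nth_oneline n k (k - i.+1) w w_sorted.
by lia.
Qed.

Lemma nth_insert_lt (l j : nat) (a b : seq nat) (d : nat) :
  (j < size a)%N -> nth d (a ++ l :: b) j = nth d (a ++ b) j.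
Proof. by move=> lt_ja; rewrite !nth_cat lt_ja. Qed.

Lemma nth_insert_ge (l j : nat) (a b : seq nat) (d : nat) :
  (size a <= j)%N -> nth d (a ++ l :: b) j.+1 = nth d (a ++ b) j.
Proof.
by move=> le_aj; rewrite !nth_cat ltnNge leqW // ltnNge le_aj subSn.
Qed.

(** Row i of the outer shape comes from the value of psi_l^*.w at the 0-based
    position j = k - i; it is absent from lambda(w) for j = 0, and otherwise its
    value is to be compared with that of w at position j - 1. Let p be the number
    of members of s below l. For 0 < j <= p the former value is larger, being the
    successor of the latter in the increasing sequence of the values of
    psi_l^*.w; for j > p the two values agree. So the rows with j <= p count. *)
Lemma hook_sharpE (n k l : nat) (w : 'S_n) (s := take k (oneline w)) :
  (k <= n)%N -> (0 < l <= n)%N -> sorted ltn s -> l \notin s ->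
  hook_sharp k l w = size [seq x <- s | x < l]%N.
Proof.
move=> le_kn l_bounds s_sorted l_s.
have t_eq := take_oneline_psi _ _ _ _ le_kn l_bounds s_sorted l_s.
have t_sorted := sorted_ltn_cat_cons _ l s_sorted.
have s_eq := cat_filter_ltn _ _ s_sorted l_s.
rewrite -/s in t_eq.
set a := [seq x <- s | x < l]%N in t_eq t_sorted s_eq *.
set b := [seq x <- s | l < x]%N in t_eq t_sorted s_eq.
have size_ab : (size a + size b = k)%N.
  by rewrite -size_cat -s_eq size_take_min size_oneline (minn_idPl le_kn).
have lt_kn : (k.+1 <= n)%N.
  have := congr1 size t_eq; rewrite size_cat /= addnS size_ab.
  by rewrite size_take_min size_oneline; lia.
rewrite /hook_sharp /skew_height size_map size_tuple.
rewrite (eq_bigr (fun i : 'I_k.+1 => (rev_ord i <= size a)%N : nat)); last first.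
  move=> i _; have lt_ik := ltn_ord i; congr (nat_of_bool _).
  rewrite (nth_map 0%N) ?size_tuple // -(tnth_nth 0%N _ i) tnth_mktuple.
  have -> : rev_ord i = (k - i)%N :> nat by rewrite /= subSS.
  have -> : (k.+1 - i).-1 = (k - i)%N by lia.
  have lt_t : (k - i < nth 0%N (oneline (psi k l w)) (k - i))%N.
    by apply: (@ltn_nth_oneline _ k.+1); rewrite ?t_eq //; lia.
  have [lt_ik'|ge_ik'] := ltnP i k; last first.
    rewrite nth_default ?size_tuple //.
    (* The bottom row, j = 0: it is empty in lambda(w), nonempty in the hook. *)
    by rewrite (_ : k - i = 0)%N ?ltnS //; lia.
  rewrite -(tnth_nth 0%N _ (Ordinal lt_ik')) tnth_mktuple /=.
  have lt_s : ((k - i).-1 < nth 0%N (oneline w) (k - i).-1)%N.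
    by apply: (@ltn_nth_oneline _ k); rewrite // le_kn andbT; lia.
  move: lt_t lt_s.
  rewrite -(@nth_take k.+1 _ 0%N (k - i)%N _ (oneline (psi k l w))); last by lia.
  rewrite -(@nth_take k _ 0%N (k - i).-1 _ (oneline w)); last by lia.
  rewrite t_eq -/s s_eq; case jE : (k - i)%N => [|j]; first by lia.
  rewrite /=; have [lt_ja|le_aj] := ltnP j (size a); last first.
    by rewrite nth_insert_ge //; lia.
  rewrite -(nth_insert_lt l j) //.
  suff : (nth 0%N (a ++ l :: b) j < nth 0%N (a ++ l :: b) j.+1)%N by lia.
  apply: (sorted_ltn_nth ltn_trans) => //; rewrite inE size_cat /=; lia.
rewrite (reindex_inj rev_ord_inj).
under eq_bigr => i _ do rewrite rev_ordK.
suff -> : (\sum_(i < k.+1) (i <= size a) = (size a).+1)%N by [].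
have <- : (\sum_(i < (size a).+1) 1 = (size a).+1)%N by rewrite sum1_card card_ord.
rewrite (big_ord_widen k.+1 (fun=> 1%N)); last by lia.
by rewrite [RHS]big_mkcond /=; apply: eq_bigr => i _; rewrite ltnS; case: leqP.
Qed.

(** * Inserting the row of the new value *)

(** The row of the alternant that belongs to the value l of w is repeated. *)
Lemma inserted_alternant_mem (n k l : nat) (w : 'S_n) :
  (k <= n)%N -> sorted ltn (take k (oneline w)) -> l \in take k (oneline w) ->
  inserted_alternant n l.-1 (grass_part k w) ord_max = 0.
Proof.
set s := take k _ => le_kn s_sorted l_s.
have size_s : size s = k by rewrite size_take_min size_oneline (minn_idPl le_kn).
have lt_q : (index l s < k)%N by rewrite -size_s index_mem.
pose i := rev_ord (Ordinal lt_q).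
apply: (determinant_alternate (i1 := ord_max) (i2 := lift ord_max i)) => [|j].
  exact: neq_lift.
rewrite !mxE unlift_none liftK grass_part_exponent // -/s.
by rewrite (_ : k - i.+1 = index l s)%N ?nth_index //= subnSK // subKn // ltnW.
Qed.

(** Rows are in decreasing order of the values, so l, which is preceded by p
    smaller values among the k + 1 values of psi_l^*.w, belongs to the row with
    k - p rows above it. *)
Lemma inserted_alternant_notin (n k l : nat) (w : 'S_n)
    (s := take k (oneline w)) (r : 'I_k.+1) :
  (k <= n)%N -> (0 < l <= n)%N -> sorted ltn s -> l \notin s ->
  r = (k - size [seq x <- s | x < l])%N :> nat ->
  inserted_alternant n l.-1 (grass_part k w) r
  = schur_alternant n (grass_part k.+1 (psi k l w)).
Proof.
move=> le_kn l_bounds s_sorted l_s.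
have t_eq := take_oneline_psi _ _ _ _ le_kn l_bounds s_sorted l_s.
have t_sorted := sorted_ltn_cat_cons _ l s_sorted.
have s_eq := cat_filter_ltn _ _ s_sorted l_s.
rewrite -/s in t_eq.
set a := [seq x <- s | x < l]%N in t_eq t_sorted s_eq *.
set b := [seq x <- s | l < x]%N in t_eq t_sorted s_eq.
move=> rE.
have size_ab : (size a + size b = k)%N.
  by rewrite -size_cat -s_eq size_take_min size_oneline (minn_idPl le_kn).
have lt_kn : (k.+1 <= n)%N.
  have := congr1 size t_eq; rewrite size_cat /= addnS size_ab.
  by rewrite size_take_min size_oneline; lia.
congr (\det _); apply/matrixP => i j; rewrite !mxE; congr (fpow _ _).
rewrite grass_part_exponent ?t_eq // subSS.
case: unliftP => /= [i' ->|->] /=.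
  rewrite grass_part_exponent // -/s s_eq rE /bump; congr (_.-1).
  have lt_i'k := ltn_ord i'.
  have [le_ri'|lt_i'r] := leqP (k - size a)%N i'.
    rewrite add1n nth_insert_lt //; lia.
  rewrite add0n (_ : k - i' = (k - i'.+1).+1)%N ?nth_insert_ge //; lia.
by rewrite rE subKn ?nth_cat ?ltnn ?subnn //; lia.
Qed.

Theorem proposition3p11 (n k l : nat) (w : 'S_n) :
  (2 <= n)%N -> (1 <= k <= n)%N -> (1 <= l <= n)%N ->
  w \in grassmannian n k ->
  shuffle (fpow ('X_ord0 : {mpoly {mpoly int[n]}[1]}) l.-1)
          (factorial_schur n (grass_part k w))
  = if l \notin take k (oneline w) then
      ((-1) ^+ hook_sharp k l w
       * factorial_schur n (grass_part (1 + k) (psi k l w)))%:F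
    else 0.
Proof.
move=> _ /andP[_ le_kn] l_bounds; rewrite inE => /andP[s_sorted _].
have V_neq0 : (vandermonde n k.+1)%:F != 0.
  by rewrite tofrac_eq0; exact: mpoly_vandermonde_neq0.
(* The quotient by the Vandermonde product is unique. *)
apply: (mulIf V_neq0); case: ifPn => [l_s|]; last rewrite negbK => l_s.
  set p := hook_sharp k l w.
  have pE := hook_sharpE _ _ _ _ le_kn l_bounds s_sorted l_s.
  have le_pk : (p <= k)%N.
    rewrite /p pE size_filter (leq_trans (count_size _ _)) //.
    by rewrite size_take_min geq_minl.
  have lt_rk : (k - p < k.+1)%N by rewrite ltnS leq_subr.
  rewrite (shuffle_vandermonde _ _ _ _ (Ordinal lt_rk)).
  rewrite inserted_alternant_notin //=; last by rewrite /p pE.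
  have -> : (-1) ^+ (k + (k - p)) = (-1) ^+ p :> {mpoly {mpoly int[n]}[k.+1]}.
    by rewrite -signr_odd oddD oddB // addKb signr_odd.
  by rewrite -factorial_schurE; exact: tofrac_mulA.
by rewrite (shuffle_vandermonde _ _ _ _ ord_max) inserted_alternant_mem // mulr0 mul0r.
Qed.
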